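(* Let $w_1\ge\dots\ge w_n\ge 1$ be integers with greatest common divisor $1$, let $\Omega=\sum_{i=1}^n w_i$, and let $\bar q\in(0,1)$ be rational. (a) For a positive integer $r$ let $\chi$ be the weighted game $[\bar q(\Omega+r);w_1,\dots,w_n,1^r]$ with $n+r$ players, the last $r$ of weight $1$. If $r\ge \max\!\left(\Omega,\frac{2+w_1}{1-\bar q}\right)$, then $\nu(\chi)=\left\lceil\frac{1}{1-q^r}\right\rceil$, where $q^r=\frac{\lceil \bar q(\Omega+r)\rceil}{\Omega+r}$. (b) For a positive integer $r$ let $\chi$ be the weighted game $[\bar q\,\Omega r;w_1^r,\dots,w_n^r]$ in which each weight $w_i$ is given to $r$ players ($nr$ players in total). There is $R$ such that for all $r\ge R$, $\nu(\chi)=\left\lceil\frac{1}{1-q^r}\right\rceil$, where $q^r=\frac{\lceil \bar q\,\Omega r\rceil}{\Omega r}$.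
   Context: A weighted game $[q;v_1,\dots,v_m]$ has players $1,\dots,m$ with weights $v_i\ge0$, and a coalition $S$ is winning iff $\sum_{i\in S}v_i\ge q$. The Nakamura number $\nu$ of a simple game is the minimum number of winning coalitions with empty intersection ($\infty$ if none exists). *)

(* Defs.v *)
From HB Require Import structures.
From mathcomp Require Import all_boot all_order all_algebra.
Set Implicit Arguments.
Unset Strict Implicit.
Unset Printing Implicit Defensive.
Import Order.TTheory GRing.Theory Num.Theory.
Local Open Scope ring_scope.

(* A game on a finite set T of players is represented by its set of winning
   coalitions. *)
Definition weighted_game (T : finType) (q : rat) (v : T -> rat) :
    {set {set T}} :=
  [set S : {set T} | q <= \sum_(i in S) v i].

(* For F = set0 the intersection is the full set of players, so an empty family
   never qualifies when there is at least one player. *)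
Definition empty_meet (T : finType) (W F : {set {set T}}) : bool :=
  (F \subset W) && (\bigcap_(S in F) S == set0).

(* None stands for infinity. *)
Definition nakamura (T : finType) (W : {set {set T}}) : option nat :=
  if [pick F | empty_meet W F] is Some F0
  then Some #|[arg min_(F < F0 | empty_meet W F) #|F|]|
  else None.

(* The weights w_1, ..., w_m, 1^r, with player set 'I_m + 'I_r. *)
Definition weights_ones (m r : nat) (w : 'I_m -> nat) (p : 'I_m + 'I_r) : rat :=
  match p with
  | inl i => (w i)%:R
  | inr _ => 1
  end.

(* The weights w_1^r, ..., w_m^r: player (i, k) is the k-th copy of player i. *)
Definition weights_copies (m r : nat) (w : 'I_m -> nat) (p : 'I_m * 'I_r) : rat :=
  (w p.1)%:R.

(* Main.v *)
Require Import Defs.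
From HB Require Import structures.
From mathcomp Require Import all_boot all_order all_algebra.
From mathcomp Require Import zify ring lra.
Set Implicit Arguments.
Unset Strict Implicit.
Unset Printing Implicit Defensive.
Import Order.TTheory GRing.Theory Num.Theory.
Local Open Scope ring_scope.

(* Passing to complements, the Nakamura number is the least number of sets of
   weight at most D = N - ceil q covering all players, where N is the total
   weight; so it is at least ceil (N / D), with equality iff the players can be
   packed into ceil (N / D) bins of capacity D.  In (a), placing the players
   greedily by decreasing weight succeeds: the first n have total weight at most
   N / 2, and the players of weight 1 fill every gap.  In (b), the copies are
   spread evenly over the bins, whose number is bounded as r grows, and the
   bounded imbalance is removed with an integer vector a such that
   sum_i a_i w_i = 1. *)

(** * Nakamura numbers and bin packings *)

Lemma mem_weighted_game (T : finType) (q : rat) (u : T -> rat) (v : T -> nat)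
    (D : nat) (S : {set T}) :
  (forall t, u t = (v t)%:R) ->
  Num.ceil q = (\sum_t v t)%N%:Z - D%:Z ->
  (S \in weighted_game q u) = (\sum_(t in ~: S) v t <= D)%N.
Proof.
move=> uE qE; rewrite inE (eq_bigr (fun t => (v t)%:R)) => [|t _]; last first.
  exact: uE.
rewrite -natr_sum [X in _ <= X]pmulrn -ceil_le_int qE (bigID (mem S)) /=.
rewrite [X in (_ = (X <= _)%N)](eq_bigl (fun t => t \notin S)) => [|t].
  by lia.
by rewrite inE.
Qed.

(** The bins are the fibres of [f]. Their complements form a winning family with empty intersection,
    and double counting shows that no smaller family works. *)
Lemma nakamura_weighted (T : finType) (q : rat) (u : T -> rat) (v : T -> nat)
    (D K : nat) (f : T -> 'I_K.+1) :
  (forall t, u t = (v t)%:R) ->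
  Num.ceil q = (\sum_t v t)%N%:Z - D%:Z ->
  (K * D < \sum_t v t)%N ->
  (forall j, \sum_(t | f t == j) v t <= D)%N ->
  nakamura (weighted_game q u) = Some K.+1.
Proof.
move=> uE qE ltKD fD.
have memW := mem_weighted_game _ uE qE.
have lbF F : empty_meet (weighted_game q u) F -> (K < #|F|)%N.
  case/andP=> /subsetP FW /eqP F0; rewrite ltnNge; apply/negP => leFK.
  move: ltKD; rewrite ltnNge => /negP; apply.
  (* Each player is missing from some member of [F], so the complements together weigh at least the
     total. *)
  apply: (@leq_trans (\sum_(S in F) \sum_(t in ~: S) v t)%N); last first.
    apply: leq_trans (leq_mul leFK (leqnn D)).
    by rewrite -sum_nat_const; apply: leq_sum => S /FW; rewrite memW.
  rewrite (exchange_big_dep xpredT) //=; apply: leq_sum => t _.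
  have : t \notin \bigcap_(S in F) S by rewrite F0 inE.
  case: (pickP (fun S => (S \in F) && (t \notin S))) => [S FS _|nS /bigcapP[]].
    by rewrite (bigD1 S) ?inE //= leq_addr.
  by move=> S FS; move: (nS S); rewrite FS /= => /negbFE.
(* Empty bins have equal complements, so only [#|F| <= K.+1] is immediate; [lbF] forces equality. *)
pose F := [set ~: [set t | f t == j] | j in [set: 'I_K.+1]].
have leF : (#|F| <= K.+1)%N.
  by apply: leq_trans (leq_imset_card _ _) _; rewrite cardsT card_ord.
have FW : empty_meet (weighted_game q u) F.
  apply/andP; split.
    apply/subsetP=> _ /imsetP[j _ ->]; rewrite memW setCK.
    by rewrite (eq_bigl (fun t => f t == j)) // => t; rewrite inE.
  apply/eqP/setP=> t; rewrite inE; apply/negP => /bigcapP.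
  by move/(_ _ (imset_f _ (in_setT (f t)))); rewrite !inE eqxx.
rewrite /nakamura; case: pickP => [F0 F0W|/(_ F)]; last by rewrite FW.
case: arg_minnP => // F1 F1W /(_ F FW) leF1.
by congr Some; apply/eqP; rewrite eqn_leq lbF // andbT (leq_trans leF1).
Qed.

(** Here [1 - q^r = D / N], and the two inequalities on [K] say that [K.+1] is the ceiling of
    [N / D]. *)
Lemma nakamura_packing (T : finType) (q : rat) (u : T -> rat) (v : T -> nat)
    (N D K : nat) (f : T -> 'I_K.+1) :
  (forall t, u t = (v t)%:R) -> (\sum_t v t)%N = N ->
  Num.ceil q = N%:Z - D%:Z ->
  (K * D < N)%N -> (N <= K.+1 * D)%N ->
  (forall j, \sum_(t | f t == j) v t <= D)%N ->
  omap Posz (nakamura (weighted_game q u)) =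
    Some (Num.ceil (1 / (1 - (Num.ceil q)%:~R / N%:R : rat))).
Proof.
move=> uE NE qE ltKD leKD fD.
rewrite (nakamura_weighted (D := D) uE _ _ fD) ?NE //= qE.
have N0 : (0 : rat) < N%:R by rewrite ltr0n; lia.
have D0 : (0 : rat) < D%:R by rewrite ltr0n; nia.
congr Some; apply/esym/ceil_def.
have -> : 1 / (1 - (N%:Z - D%:Z)%:~R / N%:R) = N%:R / D%:R :> rat.
  rewrite intrB -!pmulrn mulrBl divff ?lt0r_neq0 // opprB addrC subrK.
  by rewrite div1r invf_div.
rewrite ltr_pdivlMr // ler_pdivrMr //.
have -> : (K.+1%:Z - 1) = K%:Z by lia.
by rewrite -!pmulrn -!natrM ltr_nat ler_nat ltKD.
Qed.

(* If the current item [x] fits in no bin, every bin is more than half full: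
   either [x] weighs at most [D / 2], or every bin already holds an item at
   least as heavy as [x]. *)
Lemma greedy_packing (T : eqType) (v : T -> nat) (D K : nat) (s : seq T) :
  pairwise (fun x y => v y <= v x)%N s -> uniq s ->
  {in s, forall t, v t <= D}%N ->
  (\sum_(t <- s) v t <= K.+1 * D)%N ->
  (2 * \sum_(t <- s | 1 < v t) v t <= K.+1 * D)%N ->
  exists f : T -> 'I_K.+1, (forall j, \sum_(t <- s | f t == j) v t <= D)%N.
Proof.
elim/last_ind: s => [|s x IH].
  by move=> *; exists (fun=> ord0) => j; rewrite big_nil.
rewrite pairwise_rcons rcons_uniq !big_rcons /=.
move=> /andP[/allP vx ps] /andP[xs us] vD le1 le2.
have [|||||f fD] := IH => //; try lia.
  by move=> t ts; apply: vD; rewrite mem_rcons inE ts orbT.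
have vxD : (v x <= D)%N by apply: vD; rewrite mem_rcons inE eqxx.
have [j jx|nfit] := pickP (fun j => \sum_(t <- s | f t == j) v t + v x <= D)%N.
  exists (fun t => if t == x then j else f t) => i; rewrite big_rcons /= eqxx.
  rewrite big_seq_cond (eq_bigl (fun t => (t \in s) && (f t == i)))
    -?big_seq_cond => [|t].
    by case: (j =P i) => [<-|_] //; rewrite addn0.
  by case: (t =P x) => [->|//]; rewrite (negbTE xs).
have part : (\sum_(t <- s) v t = \sum_j \sum_(t <- s | f t == j) v t)%N.
  by rewrite (partition_big f xpredT).
(* An item of weight 0 would fit. If one of weight 1 fits nowhere, all bins are full, against the
   bound on the total. *)
have [vx1|vx1] := leqP (v x) 1.
  have v1 : v x = 1%N by move: (nfit ord0) (fD ord0); lia.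
  have : (K.+1 * D <= \sum_(t <- s) v t)%N.
    rewrite part -[X in (X * _)%N]card_ord -sum_nat_const; apply: leq_sum => j _.
    by move: (nfit j); rewrite v1; lia.
  lia.
have half j : (D < 2 * \sum_(t <- s | f t == j) v t)%N.
  have := nfit j; have [small|big] := leqP (2 * v x) D; first lia.
  case: (boolP (has (fun t => f t == j) s)) => [/hasP[y ys fy] _|].
    rewrite (big_rem y) //= fy; have := vx y ys; lia.
  move/hasPn => nj; rewrite big_seq_cond big_pred0 ?add0n ?vxD // => t.
  by case ts: (t \in s) => //=; apply/negbTE/nj.
have : (K.+1 * D <= 2 * \sum_(t <- s) v t)%N.
  rewrite part big_distrr -[X in (X * _)%N]card_ord -sum_nat_const.
  by apply: leq_sum => j _; apply: ltnW.
(* By the decreasing order, all items placed before [x] are heavier than 1, so the bound on heavy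
   items applies to them. *)
have : (\sum_(t <- s) v t = \sum_(t <- s | 1 < v t) v t)%N.
  rewrite big_seq [RHS]big_seq_cond; apply: eq_bigl => t.
  by case ts: (t \in s) => //=; rewrite (leq_trans vx1) // vx.
by move: le2; rewrite vx1 /=; lia.
Qed.

Lemma greedy_packing_fin (T : finType) (v : T -> nat) (D K : nat) :
  (forall t, v t <= D)%N ->
  (\sum_t v t <= K.+1 * D)%N ->
  (2 * \sum_(t | 1 < v t) v t <= K.+1 * D)%N ->
  exists f : T -> 'I_K.+1, (forall j, \sum_(t | f t == j) v t <= D)%N.
Proof.
move=> vD le1 le2; pose leT x y := (v y <= v x)%N.
pose s := sort leT (index_enum T).
have ps : perm_eq (index_enum T) s by rewrite perm_sym perm_sort.
have [| | | | |f fD] := @greedy_packing _ v D K s.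
- rewrite -sorted_pairwise => [|y x z xy yz]; last exact: leq_trans yz xy.
  by apply: sort_sorted => x y; apply: leq_total.
- by rewrite sort_uniq index_enum_uniq.
- by [].
- by rewrite -(perm_big _ ps).
- by rewrite -(perm_big _ ps).
by exists f => j; rewrite (perm_big _ ps).
Qed.

(** * Packing many copies of each weight *)

Lemma Bezout_big (I : finType) (w : I -> nat) :
  exists a : I -> int, \sum_i a i * (w i)%:Z = (\big[gcdn/0%N]_i w i)%:Z.
Proof.
elim/big_ind: _ => [|x y [a aE] [b bE]|i _].
- by exists (fun=> 0); rewrite big1 // => i _; rewrite mul0r.
- have [u [v uv]] := Bezoutz x y; exists (fun i => u * a i + v * b i).
  rewrite -[RHS]/(gcdz x y) -uv -aE -bE !big_distrr -big_split /=.
  by apply: eq_bigr => i _; rewrite mulrDl !mulrA.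
exists (fun j => (j == i)%:Z); rewrite (bigD1 i) //= eqxx mul1r big1 ?addr0 //.
by move=> j /negbTE ->; rewrite mul0r.
Qed.

Lemma ord_fun_of_counts (r k : nat) (c : 'I_k -> nat) :
  (\sum_j c j)%N = r ->
  exists g : 'I_r -> 'I_k, forall j, #|[pred x | g x == j]| = c j.
Proof.
move=> cr; pose s := flatten [seq nseq (c j) j | j <- enum 'I_k].
have ss : size s == r.
  rewrite size_flatten /shape -map_comp sumnE big_map -cr big_enum /=.
  by apply/eqP/eq_bigr => j _; rewrite size_nseq.
exists (tnth (Tuple ss)) => j.
have -> : #|[pred x | tnth (Tuple ss) x == j]| = count (pred1 j) s.
  have sE : s = map (tnth (Tuple ss)) (enum 'I_r) by rewrite map_tnth_enum.
  rewrite [in RHS]sE count_map.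
  by rewrite cardE size_filter enumT.
rewrite count_flatten -map_comp sumnE big_map big_enum /= (bigD1 j) //=.
rewrite count_nseq /= eqxx mul1n big1 ?addn0 // => i /negbTE ij.
by rewrite count_nseq /= ij.
Qed.

(* With [r = K.+1 * s + t], each bin first gets [s] copies of every weight and
   bin [0] the [t] remaining ones; transferring the vector [d *: a] from bin [0]
   to another bin then moves exactly the weight [d]. *)
Lemma copies_packing (m r K D : nat) (w : 'I_m -> nat) (a : 'I_m -> int)
    (Omega := (\sum_i w i)%N) :
  \sum_i a i * (w i)%:Z = 1 ->
  (Omega * r <= K.+1 * D)%N ->
  (forall i, `|a i| * (Omega * K.+1 * K.+1) <= r %/ K.+1)%N ->
  exists f : 'I_m * 'I_r -> 'I_K.+1,
    forall j, (\sum_(p | f p == j) w p.1 <= D)%N.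
Proof.
move=> aw leD aB; set s := (r %/ K.+1)%N in aB.
pose t := (r %% K.+1)%N; have rE : r = (s * K.+1 + t)%N by apply: divn_eq.
have tK : (t <= K)%N by rewrite -ltnS ltn_pmod.
have sD : (Omega * s <= D)%N.
  by rewrite -(leq_pmul2l (ltn0Sn K)); apply: leq_trans leD; nia.
(* Each bin other than bin 0 receives its free space, capped by the excess of bin 0. *)
pose d := minn (D - Omega * s) (Omega * t).
have dB : (K.+1 * d <= Omega * K.+1 * K.+1)%N.
  by rewrite mulnC leq_mul2r /= (leq_trans (geq_minr _ _)) // leq_mul2l; lia.
pose c i (j : 'I_K.+1) : int :=
  if j == ord0 then s%:Z + t%:Z - a i * (K * d)%N%:Z else s%:Z + a i * d%:Z.
(* Largeness of [r] enters here: transfers never exceed [s], so the counts [c i j] stay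
   nonnegative. *)
have bound i e : (e <= K.+1 * d)%N -> `|a i * e%:Z| <= s%:Z.
  move=> eB; rewrite normrM.
  apply: le_trans (_ : (`|a i| * (Omega * K.+1 * K.+1))%N%:Z <= _).
    by rewrite PoszM abszE ler_wpM2l // ger0_norm // lez_nat (leq_trans eB).
  by rewrite lez_nat aB.
have c0 i j : 0 <= c i j.
  rewrite /c; case: ifP => _.
    by have := bound i (K * d)%N; rewrite leq_mul2r leqnSn orbT => /(_ isT); lia.
  by have := bound i d; rewrite leq_pmull // => /(_ isT); lia.
have csum i : (\sum_j `|c i j| = r)%N.
  have absK j : `|c i j|%N%:Z = c i j by rewrite gez0_abs.
  apply: (can_inj absz_nat); rewrite (big_morph Posz PoszD (erefl _)).
  rewrite (eq_bigr (c i)) // big_ord_recl /= /c eqxx.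
  by rewrite sumr_const card_ord -mulr_natl natz [in RHS]rE; nia.
have [g gE] : exists g : 'I_m -> 'I_r -> 'I_K.+1,
    forall i j, #|[pred x | g i x == j]| = `|c i j|%N.
  by apply: (fin_all_exists (fun i => ord_fun_of_counts (csum i))).
exists (fun p => g p.1 p.2) => j.
have -> : (\sum_(p | g p.1 p.2 == j) w p.1 = \sum_i `|c i j| * w i)%N.
  rewrite -(pair_big_dep xpredT (fun i x => g i x == j) (fun i _ => w i)) /=.
  by apply: eq_bigr => i _; rewrite sum_nat_const gE.
have awd (e : int) : \sum_i a i * e * (w i)%:Z = e.
  by rewrite -[RHS]mulr1 -aw big_distrr; apply: eq_bigr => i _ /=; ring.
have cw (e : nat) : \sum_i e%:Z * (w i)%:Z = (Omega * e)%N%:Z.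
  by rewrite -big_distrr PoszM mulrC /= /Omega (big_morph Posz PoszD (erefl _)).
rewrite -lez_nat (big_morph Posz PoszD (erefl _)).
rewrite (eq_bigr (fun i => c i j * (w i)%:Z)) => [|i _]; last first.
  by rewrite PoszM gez0_abs.
rewrite /c; case: (j == ord0).
  (* Bin 0 carries [Omega * (s + t) - K * d]. If the other bins are full, the bound on the total
     suffices; if [d = Omega * t], the load is at most [Omega * s], since [t = 0] when [K = 0]. *)
  rewrite (eq_bigr (fun i =>
    (s + t)%N%:Z * (w i)%:Z - a i * (K * d)%N%:Z * (w i)%:Z)).
    rewrite sumrB awd cw; move: sD leD; rewrite rE /d /minn; case: ifP; nia.
  by move=> i _; rewrite -PoszD mulrBl.
under eq_bigr do rewrite mulrDl.
by rewrite big_split /= awd cw -PoszD lez_nat -leq_subRL // geq_minl.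
Qed.

(** * Rounding estimates and the theorem *)

Lemma ceil_complement (q : rat) (N : nat) : q <= N%:R ->
  exists D : nat, Num.ceil q = N%:Z - D%:Z /\ N%:R - q - 1 < D%:R.
Proof.
move=> qN; have leN : Num.ceil q <= N%:Z by rewrite ceil_le_int -pmulrn.
exists `|N%:Z - Num.ceil q|%N; split; first by lia.
have := ceilB1_lt q; rewrite intrB; move: (Num.ceil q) leN => c leN lt_cq.
by rewrite [X in _ < X]pmulrn gez0_abs ?subr_ge0 // intrB -pmulrn; lra.
Qed.

(** The predecessor makes [K.+1] the ceiling of [N / D] even when [D] divides [N]. *)
Lemma ceil_divn_bounds (N D : nat) (K := (N.-1 %/ D)%N) :
  (0 < N)%N -> (0 < D)%N -> (K * D < N)%N /\ (N <= K.+1 * D)%N.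
Proof.
move=> N0 D0; have := leq_divM N.-1 D; have := ltn_ceil N.-1 D0.
by rewrite -/K; lia.
Qed.

Theorem theorem2 (n : nat) (w : 'I_n.+1 -> nat) (qbar : rat)
  (w_noninc : forall i j : 'I_n.+1, (i <= j)%N -> (w j <= w i)%N)
  (w_ge1 : forall i : 'I_n.+1, (1 <= w i)%N)
  (w_gcd : \big[gcdn/0%N]_(i < n.+1) w i = 1%N)
  (qbar_gt0 : 0 < qbar) (qbar_lt1 : qbar < 1) :
  let Omega : nat := (\sum_(i < n.+1) w i)%N in
  (forall r : nat, (0 < r)%N ->
     Num.max Omega%:R ((2 + (w ord0)%:R) / (1 - qbar)) <= r%:R :> rat ->
     let qr : rat := (Num.ceil (qbar * (Omega + r)%:R))%:~R / (Omega + r)%:R in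
     omap Posz (nakamura (weighted_game (qbar * (Omega + r)%:R)
                                        (@weights_ones n.+1 r w)))
     = Some (Num.ceil (1 / (1 - qr))))
  /\
  (exists R : nat, forall r : nat, (0 < r)%N -> (R <= r)%N ->
     let qr : rat := (Num.ceil (qbar * (Omega * r)%:R))%:~R / (Omega * r)%:R in
     omap Posz (nakamura (weighted_game (qbar * (Omega * r)%:R)
                                        (@weights_copies n.+1 r w)))
     = Some (Num.ceil (1 / (1 - qr)))).
Proof.
move=> Omega.
have Omega_gt0 : (0 < Omega)%N.
  by rewrite /Omega big_ord_recl; have := w_ge1 ord0; lia.
have OmegaQ : 1 <= Omega%:R :> rat by rewrite ler1n.
have wle i : (w i <= w ord0)%N by apply: w_noninc.
have q1 : 0 < 1 - qbar by rewrite subr_gt0.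
split=> [r r_gt0|].
  rewrite ge_max ler_nat ler_pdivrMr // => /andP[le_r r_big] qr.
  pose v (p : 'I_n.+1 + 'I_r) := if p is inl i then w i else 1%N.
  have vsum : (\sum_p v p = Omega + r)%N.
    by rewrite big_sumType /= sum1_card card_ord.
  (* Since [Omega <= r], this is at most half of the total weight. *)
  have vbig : (\sum_(p | (1 < v p)%N) v p <= Omega)%N.
    rewrite big_sumType /= big_pred0_eq addn0 big_mkcond /=.
    by apply: leq_sum => i _; case: ifP.
  have [|D [DE ltD]] := @ceil_complement (qbar * (Omega + r)%:R) (Omega + r).
    by rewrite ler_piMl // ltW.
  (* From [r * (1 - qbar) >= 2 + w ord0], even after the loss of less than 1 by rounding; hence
     every player fits in a bin. *)
  have w0D : (w ord0 < D)%N.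
    by rewrite -(ltr_nat rat); move: ltD; rewrite natrD; nra.
  have [||KD DK] := @ceil_divn_bounds (Omega + r) D; try lia.
  have [| | |f fD] := @greedy_packing_fin _ v D ((Omega + r).-1 %/ D).
  - by case=> [i|_] /=; [have := wle i|]; lia.
  - by rewrite vsum.
  - lia.
  by apply: (nakamura_packing _ vsum DE KD DK fD); case.
have [a] := Bezout_big w; rewrite w_gcd => aw.
pose A := (\sum_i `|a i|)%N; pose K0 := `|Num.ceil (2 / (1 - qbar))|%N.
have K0E : 2 / (1 - qbar) <= K0%:R.
  by apply: le_trans (ceil_ge _) _; rewrite [X in _ <= X]pmulrn ler_int abszE ler_norm.
(* The condition of [copies_packing] at the largest possible [K], namely [K0], with [A] bounding all
   [|a i|]; the successor of the second factor also ensures [K0 < r]. *)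
exists (K0.+1 * (A * (Omega * K0.+1 * K0.+1)).+1)%N => r r_gt0 r_big qr.
have vsum : (\sum_(p : 'I_n.+1 * 'I_r) w p.1 = Omega * r)%N.
  rewrite -(pair_bigA _ (fun i _ => w i)) /= big_distrl /=; apply: eq_bigr => i _.
  by rewrite sum_nat_const card_ord mulnC.
have [|D [DE ltD]] := @ceil_complement (qbar * (Omega * r)%:R) (Omega * r).
  by rewrite ler_piMl // ltW.
have rK0 : 2 < r%:R * (1 - qbar).
  rewrite -ltr_pdivrMr //; apply: le_lt_trans K0E _; rewrite ltr_nat.
  by apply: leq_trans r_big; rewrite leq_pmulr.
have rN : r%:R <= (Omega * r)%:R :> rat by rewrite ler_nat leq_pmull.
have D0 : 0 < D%:R :> rat by nra.
have [||KD DK] := @ceil_divn_bounds (Omega * r) D.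
- by rewrite muln_gt0 Omega_gt0.
- by rewrite -(ltr_nat rat).
set K := (_ %/ D)%N in KD DK.
(* With [N = Omega * r], [N * (1 - qbar) > 2] gives [D >= N * (1 - qbar) / 2], and [K * D < N] then
   bounds [K] by [2 / (1 - qbar)], independently of [r]. *)
have KK0 : (K <= K0)%N.
  rewrite -(ler_nat rat); apply: le_trans K0E; rewrite ler_pdivlMr // leNgt.
  apply/negP => Kbig.
  move: KD; rewrite -(ltr_nat rat) natrM => KD.
  have K_ge0 : 0 <= K%:R :> rat by rewrite ler0n.
  move: (K%:R : rat) (D%:R : rat) ((Omega * r)%:R : rat) (r%:R : rat)
    KD ltD rN rK0 Kbig K_ge0 => k d N s KD ltD rN rK0 Kbig K_ge0.
  have Nd : N * (1 - qbar) <= 2 * d by nra.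
  have : k * (N * (1 - qbar)) <= k * (2 * d) by rewrite ler_wpM2l.
  have : N * 2 < N * (k * (1 - qbar)) by rewrite ltr_pM2l //; nra.
  nra.
have [|f fD] := @copies_packing _ r K D w a aw DK.
  move=> i; rewrite leq_divRL //.
  have aA : (`|a i| <= A)%N by rewrite /A (bigD1 i) //= leq_addr.
  by apply: leq_trans r_big; rewrite mulnC leq_mul // leqW // !leq_mul.
by apply: (nakamura_packing _ vsum DE KD DK fD).
Qed.
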